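(* Let $k,\rho,c,\gamma,q_0,h_0,D_\infty>0$ and $0<\epsilon<1$ be given, and consider the latent heat $l>0$ as an unknown of the free boundary problem (P) described in the context. Then the solution of (P), including the unknown coefficient $l$, is given by, with $\alpha=\frac{k}{\rho c}$, $$T(x,t)=\frac{q_0\sqrt{\pi\alpha}}{k}\left[\operatorname{erf}\left(\frac{x}{2\sqrt{\alpha t}}\right)-\operatorname{erf}(\xi)\right]\quad (0<x<s(t),\ t>0),$$ $$s(t)=2\xi\sqrt{\alpha t},\qquad r(t)=2\left[\xi+\frac{\gamma k}{2q_0\sqrt{\alpha}}\exp(\xi^2)\right]\sqrt{\alpha t}\quad (t>0),$$ with $l>0$ and $\xi>0$ given by $$l=\sqrt{\frac{c}{\rho k}}\;\frac{q_0\exp(-\xi^2)}{\xi+\frac{\gamma(1-\epsilon)\sqrt{k\rho c}}{2q_0}\exp(\xi^2)},\qquad \xi=\operatorname{erf}^{-1}\left(\frac{D_\infty}{q_0}\sqrt{\frac{k\rho c}{\pi}}\left(1-\frac{q_0}{h_0D_\infty}\right)\right),$$ if and only if the following two inequalities hold: $$1-\frac{q_0}{h_0D_\infty}>0,\qquad \frac{D_\infty}{q_0}\sqrt{\frac{k\rho c}{\pi}}\left(1-\frac{q_0}{h_0D_\infty}\right)<1.$$ (That is: there exist $l>0$ and $\xi>0$ such that the triple $(T,s,r)$ with $T(x,t)=\frac{q_0\sqrt{\pi\alpha}}{k}\left[\operatorname{erf}\left(\frac{x}{2\sqrt{\alpha t}}\right)-\operatorname{erf}(\xi)\right]$, $s(t)=2\xi\sqrt{\alpha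 t}$ and $r(t)=2\left[\xi+\frac{\gamma k}{2q_0\sqrt{\alpha}}\exp(\xi^2)\right]\sqrt{\alpha t}$ solves (P) if and only if these inequalities hold, and in that case $\xi=\operatorname{erf}^{-1}\left(\frac{D_\infty}{q_0}\sqrt{\frac{k\rho c}{\pi}}\left(1-\frac{q_0}{h_0D_\infty}\right)\right)$ and $l=\sqrt{\frac{c}{\rho k}}\;\frac{q_0\exp(-\xi^2)}{\xi+\frac{\gamma(1-\epsilon)\sqrt{k\rho c}}{2q_0}\exp(\xi^2)}$.)
   Context: Problem (P): find $T=T(x,t)$ and free boundaries $x=s(t)$, $x=r(t)$ such that $$\rho c\,T_t(x,t)-kT_{xx}(x,t)=0,\quad 0<x<s(t),\ t>0;$$ $$T(s(t),t)=0,\quad t>0;$$ $$kT_x(s(t),t)=\rho l\,[\epsilon\dot s(t)+(1-\epsilon)\dot r(t)],\quad t>0;$$ $$T_x(s(t),t)\,(r(t)-s(t))=\gamma,\quad t>0;$$ $$r(0)=s(0)=0;$$ $$kT_x(0,t)=\frac{q_0}{\sqrt t},\quad t>0;$$ $$kT_x(0,t)=\frac{h_0}{\sqrt t}\,(T(0,t)+D_\infty),\quad t>0.$$ All parameters $l,k,\rho,c,\gamma,q_0,h_0,D_\infty$ are positive real constants and $0<\epsilon<1$. Here $T$ and $T_x$ at $x=0$ and $x=s(t)$ are the boundary values from $0<x<s(t)$. The error function is $\operatorname{erf}(x)=\frac{2}{\sqrt\pi}\int_0^x e^{-u^2}\,du$, and $\operatorname{erf}^{-1}:(0,1)\to(0,\infty)$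 is the inverse of its restriction to $(0,\infty)$. *)

(* Defs.v *)
From HB Require Import structures.
From mathcomp Require Import all_boot all_order all_algebra.
From mathcomp Require Import all_classical all_reals all_analysis.

Set Implicit Arguments.
Unset Strict Implicit.
Unset Printing Implicit Defensive.

Import Order.TTheory GRing.Theory Num.Theory.
Import numFieldNormedType.Exports.

Local Open Scope classical_set_scope.
Local Open Scope ring_scope.

Section ErrorFunction.
Context {R : realType}.

(* The integral is oriented: `[a, b] is empty when b < a, so at most one of the
   two terms is nonzero. *)
Definition erf (x : R) : R :=
  2 / Num.sqrt pi *
    (\int[lebesgue_measure]_(u in `[0, x]) expR (- u ^+ 2)
     - \int[lebesgue_measure]_(u in `[x, 0]) expR (- u ^+ 2)).

(* Inverse of the restriction of erf to ]0, +oo[; the value outside of the range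
   ]0, 1[ is the dummy 0. *)
Definition erf_inv (y : R) : R := xget 0 [set x | 0 < x /\ erf x = y].

End ErrorFunction.

Section FreeBoundaryProblem.
Context {R : realType}.
Implicit Types (f s r : R -> R) (T : R -> R -> R).

Definition cvg_bval_right f (a : R) : Prop := cvg (f x @[x --> a^'+]).
Definition cvg_bval_left f (a : R) : Prop := cvg (f x @[x --> a^'-]).
Definition bval_right f (a : R) : R := lim (f x @[x --> a^'+]).
Definition bval_left f (a : R) : R := lim (f x @[x --> a^'-]).

Definition dx T (x t : R) : R := derive1 (fun y => T y t) x.
Definition dt T (x t : R) : R := derive1 (fun u => T x u) t.

(* T is a total function, but only its values on 0 < x < s t, t > 0 are
   meaningful: T and T_x at x = 0 and x = s t are one-sided limits in x at fixed
   t. Since lim and derive1 are total, existence of the limits and derivatives is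
   required separately. *)
Record solves_P (k rho c gamma q0 h0 Dinf eps l : R) T s r : Prop := SolvesP {
  P_pos : forall t : R, 0 < t -> 0 < s t ;
  P_regular : forall x t : R, 0 < t -> 0 < x -> x < s t ->
    [/\ derivable (fun u => T x u) t 1,
        derivable (fun y => T y t) x 1 &
        derivable (fun y => dx T y t) x 1] ;
  P_derivable : forall t : R, 0 < t -> derivable s t 1 /\ derivable r t 1 ;
  P_cvg_s : forall t : R, 0 < t ->
    cvg_bval_left (fun x => T x t) (s t) /\
    cvg_bval_left (fun x => dx T x t) (s t) ;
  P_cvg_0 : forall t : R, 0 < t ->
    cvg_bval_right (fun x => T x t) 0 /\
    cvg_bval_right (fun x => dx T x t) 0 ;
  P_heat : forall x t : R, 0 < t -> 0 < x -> x < s t ->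
    rho * c * dt T x t - k * dx (dx T) x t = 0 ;
  P_temp_s : forall t : R, 0 < t -> bval_left (fun x => T x t) (s t) = 0 ;
  P_flux_s : forall t : R, 0 < t ->
    k * bval_left (fun x => dx T x t) (s t) =
      rho * l * (eps * derive1 s t + (1 - eps) * derive1 r t) ;
  P_mushy : forall t : R, 0 < t ->
    bval_left (fun x => dx T x t) (s t) * (r t - s t) = gamma ;
  P_init : r 0 = 0 /\ s 0 = 0 ;
  P_flux_0 : forall t : R, 0 < t ->
    k * bval_right (fun x => dx T x t) 0 = q0 / Num.sqrt t ;
  P_convective_0 : forall t : R, 0 < t ->
    k * bval_right (fun x => dx T x t) 0 =
      h0 / Num.sqrt t * (bval_right (fun x => T x t) 0 + Dinf)
}.

Definition similarity_form (k rho c gamma q0 xi : R) T s r : Prop :=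
  let alpha := k / (rho * c) in
  [/\ forall x t : R, 0 < t -> 0 < x -> x < s t ->
        T x t = q0 * Num.sqrt (pi * alpha) / k *
                  (erf (x / (2 * Num.sqrt (alpha * t))) - erf xi),
      forall t : R, 0 < t -> s t = 2 * xi * Num.sqrt (alpha * t) &
      forall t : R, 0 < t ->
        r t = 2 * (xi + gamma * k / (2 * q0 * Num.sqrt alpha) * expR (xi ^+ 2))
                * Num.sqrt (alpha * t)].

End FreeBoundaryProblem.

(* Main.v *)
(* For a triple of similarity form, the heat equation, the condition T = 0 at s
   and the conditions on T_x at 0 and on the mushy zone hold for every xi > 0. In
   the two remaining conditions all powers of t cancel: the convective condition at
   0 prescribes the value of erf xi, and the flux condition at s then determines l.
   Since erf is a strictly increasing bijection from ]0, +oo[ onto ]0, 1[, an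
   admissible xi exists iff that value lies strictly between 0 and 1. *)

Require Import Defs.
From mathcomp Require Import all_boot all_order all_algebra.
From mathcomp Require Import all_classical all_reals all_analysis.
From mathcomp Require Import ring.
Set Implicit Arguments.
Unset Strict Implicit.
Import Order.TTheory GRing.Theory Num.Theory.
Import numFieldNormedType.Exports.
Local Open Scope classical_set_scope.
Local Open Scope ring_scope.

(** * Error function: derivative, monotonicity, range and inverse *)

Section erf_theory.
Context {R : realType}.
Implicit Types x y : R.
Notation mu := (@lebesgue_measure R).

Let integrable_gauss (i : interval R) : mu.-integrable [set` i] (EFin \o @gauss_fun R).
Proof. exact: (integrableS measurableT _ _ integrableT_gauss). Qed.

(* Integrating from -oo gives a formula for erf valid on both sides of 0, so that
   the fundamental theorem of calculus also applies at 0. *)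
Let G x := (\int[mu]_(u in `]-oo, x]) gauss_fun u)%R.

Let GB x y : x <= y -> G y - G x = (\int[mu]_(u in `[x, y]) gauss_fun u)%R.
Proof.
move=> xy; rewrite /G Rintegral_itvB ?bnd_simp//.
by rewrite Rintegral_itv_obnd_cbnd.
Qed.

Let erfE x : erf x = 2 / Num.sqrt pi * (G x - G 0).
Proof.
rewrite /erf; congr (_ * _).
have I0 a b : b <= a -> \int[mu]_(u in `[a, b]) gauss_fun u = 0 :> R.
  rewrite le_eqVlt => /predU1P[->|ba]; first by rewrite set_itv1 Rintegral_set1.
  by rewrite set_itv_ge ?Rintegral_set0// bnd_simp -ltNge.
have [x0|/ltW x0] := leP 0 x.
  by rewrite [X in _ - X](I0 _ _ x0) subr0 -GB.
by rewrite [X in X - _](I0 _ _ x0) sub0r -GB// opprB.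
Qed.

Lemma erf0 : erf (0 : R) = 0.
Proof. by rewrite erfE subrr mulr0. Qed.

(** An instance, so that [is_derive_eq] can later differentiate composites containing [erf] by type
    class resolution. *)
Global Instance is_derive_erf x :
  is_derive x 1 erf (2 / Num.sqrt pi * expR (- x ^+ 2)).
Proof.
have -> : erf = (2 / Num.sqrt pi) \*: (G - cst (G 0) : R -> R).
  by apply/funext => y; rewrite erfE.
have [dG GE] : derivable G x 1 /\ derive1 G x = gauss_fun x.
  (* [x + 1] is just some right end beyond [x], making [x] an interior point. *)
  apply: (@continuous_FTC1 _ (@gauss_fun R) -oo%O x (x + 1)) => //.
  - by rewrite ltrDl.
  - by rewrite ltNyr.
  - exact: continuous_gauss_fun.
rewrite derive1E in GE.
have DG : is_derive x 1 G (gauss_fun x) by exact: DeriveDef.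
by apply: is_derive_eq; rewrite subr0.
Qed.

Lemma continuous_erf : continuous (@erf R).
Proof.
move=> x; apply: differentiable_continuous; apply/derivable1_diffP.
exact: ex_derive.
Qed.

Lemma erf_incr x y : x < y -> erf x < erf y.
Proof.
move=> xy.
have [|c _ ] := @MVT _ erf _ x y xy (fun z _ => is_derive_erf z).
  by apply: continuous_subspaceT; exact: continuous_erf.
move=> e; rewrite -subr_gt0 e !mulr_gt0 ?subr_gt0 ?expR_gt0//.
by rewrite invr_gt0 sqrtr_gt0 pi_gt0.
Qed.

Lemma erf_inj : injective (@erf R).
Proof.
move=> x y; case: (ltgtP x y) => // /erf_incr + e; by rewrite e ltxx.
Qed.

(** The Gaussian integral: the squared integral over [[0, x]] tends to [pi / 4], its root is the
    integral itself by nonnegativity, and the factor [2 / Num.sqrt pi] normalises the limit. *)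
Lemma cvg_erf : erf x @[x --> +oo] --> (1 : R).
Proof.
have spi0 : 0 < Num.sqrt (pi : R) by rewrite sqrtr_gt0 pi_gt0.
have -> : 1 = 2 / Num.sqrt pi * Num.sqrt (pi / 4) :> R.
  rewrite sqrtrM ?pi_ge0// sqrtrV// (_ : 4 = 2 ^+ 2 :> R); last by ring.
  by rewrite sqrtr_sqr ger0_norm//; field; rewrite gt_eqF.
have : Num.sqrt (gauss_integral_proof.integral0_gauss x ^+ 2) @[x --> +oo]
    --> Num.sqrt (pi / 4 : R).
  apply: continuous_cvg; first exact: sqrt_continuous.
  exact: gauss_integral_proof.cvg_integral0_gauss_sqr.
move=> /(cvgM (cvg_cst (2 / Num.sqrt pi : R))).
apply: cvg_trans; apply: near_eq_cvg; near=> x.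
have x0 : 0 <= x by near: x; exact: nbhs_pinfty_ge.
rewrite /= sqrtr_sqr ger0_norm; last exact: gauss_integral_proof.integral0_gauss_ge0.
by rewrite erfE GB.
Unshelve. all: by end_near. Qed.

(** Passing to the limit gives only a weak bound; the detour through [x + 1] and strict monotonicity
    make it strict. *)
Lemma erf_lt1 x : erf x < 1.
Proof.
apply: (@lt_le_trans _ _ (erf (x + 1))); first by rewrite erf_incr ?ltrDl.
rewrite -[leRHS](cvg_lim _ cvg_erf)//.
apply: limr_ge; first by apply/cvg_ex; exists 1; exact: cvg_erf.
near=> y.
have : x + 1 <= y by near: y; apply: nbhs_pinfty_ge; rewrite num_real.
by rewrite le_eqVlt => /predU1P[<-|/erf_incr/ltW].
Unshelve. all: by end_near. Qed.

Lemma erf_gt0 x : 0 < x -> 0 < erf x.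
Proof. by move=> /erf_incr; rewrite erf0. Qed.

(** Intermediate values on [[0, M]], where [M] comes from the limit 1 at infinity. The point found
    is not 0 because [erf 0 = 0 < y]. *)
Lemma erf_surj y : 0 < y < 1 -> exists2 x, 0 < x & erf x = y.
Proof.
move=> /andP[y0 y1].
have [M [M0 yM]] : exists M : R, 0 <= M /\ y < erf M.
  near (pinfty_nbhs R) => M; exists M; split; first by near: M; exact: nbhs_pinfty_ge.
  by near: M; apply: (cvgr_gt (1 : R)) => //; exact: cvg_erf.
have [||x xM xy] := @IVT _ erf 0 M y M0.
- by apply: continuous_subspaceT; exact: continuous_erf.
- have M1 := le_trans (ltW y0) (ltW yM).
  by rewrite erf0 min_l// max_r// !ltW.
exists x => //; rewrite lt_neqAle eq_sym; apply/andP; split.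
  by apply/eqP => x0; move: y0; rewrite -xy x0 erf0 ltxx.
by move: xM; rewrite in_itv/= => /andP[].
Unshelve. all: by end_near. Qed.

(** Whatever preimage [xget] selects is [x] by injectivity, and [x] itself rules out the dummy
    value. *)
Lemma erf_invK x : 0 < x -> erf_inv (erf x) = x.
Proof.
move=> x0; rewrite /erf_inv; case: xgetP => [z _ /= [_ /erf_inj]//|/(_ x) []].
by split.
Qed.

End erf_theory.

(** * Derivatives and one-sided boundary values *)

Section derivatives.
Context {R : realType}.
Implicit Types f g : R -> R.

Lemma is_derive1_cvg f (x df : R) : is_derive x 1 f df -> f y @[y --> x] --> f x.
Proof. by move=> [dfx _]; exact/differentiable_continuous/derivable1_diffP. Qed.

Lemma is_derive1E f (x df : R) : is_derive x 1 f df -> derive1 f x = df.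
Proof. by move=> [_ <-]; rewrite derive1E. Qed.

Lemma bval_leftP f (a l : R) : f x @[x --> a^'-] --> l ->
  cvg_bval_left f a /\ bval_left f a = l.
Proof. by move=> fl; split; [apply/cvg_ex; exists l | exact/cvg_lim]. Qed.

Lemma bval_rightP f (a l : R) : f x @[x --> a^'+] --> l ->
  cvg_bval_right f a /\ bval_right f a = l.
Proof. by move=> fl; split; [apply/cvg_ex; exists l | exact/cvg_lim]. Qed.

End derivatives.

(** * Derivatives of the similarity temperature profile *)

Section similarity_profile.
Context {R : realType} (k alpha q0 xi : R)
  (k_gt0 : 0 < k) (alpha_gt0 : 0 < alpha).

Definition sim_temp (x t : R) : R :=
  q0 * Num.sqrt (pi * alpha) / k * (erf (x / (2 * Num.sqrt (alpha * t))) - erf xi).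

Definition sim_grad (x t : R) : R :=
  q0 / (k * Num.sqrt t) * expR (- (x / (2 * Num.sqrt (alpha * t))) ^+ 2).

Let sqrt_pi : 0 < Num.sqrt (pi : R).
Proof. by rewrite sqrtr_gt0 pi_gt0. Qed.

Let sqrt_alpha : 0 < Num.sqrt alpha.
Proof. by rewrite sqrtr_gt0. Qed.

Lemma is_derive_sim_temp_x (x t : R) : 0 < t ->
  is_derive x 1 (sim_temp ^~ t) (sim_grad x t).
Proof.
move=> t0; have st : 0 < Num.sqrt t by rewrite sqrtr_gt0.
rewrite /sim_temp; apply: is_derive_eq.
rewrite /sim_grad; set e := expR _; rewrite /GRing.scale/=.
rewrite sqrtrM ?pi_ge0// sqrtrM ?(ltW alpha_gt0)//.
by field; rewrite !gt_eqF.
Qed.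

Lemma is_derive_sim_grad_x (x t : R) : 0 < t ->
  is_derive x 1 (sim_grad ^~ t) (sim_grad x t * - (x / (2 * alpha * t))).
Proof.
move=> t0; have st : 0 < Num.sqrt t by rewrite sqrtr_gt0.
rewrite /sim_grad; apply: is_derive_eq.
set e := expR _; rewrite /GRing.scale/=.
(* Writing [alpha] and [t] as squares of their roots leaves [field] a rational identity in the
   roots. *)
have aE := sqr_sqrtr (ltW alpha_gt0); have tE := sqr_sqrtr (ltW t0).
rewrite sqrtrM ?(ltW alpha_gt0)//; set a := Num.sqrt alpha in aE *.
by set b := Num.sqrt t in tE *; rewrite -aE -tE; field; rewrite !gt_eqF.
Qed.

(** The derivative is kept in the form [alpha] times the second derivative in [x], which is the heat
    equation for the profile. *)
Lemma is_derive_sim_temp_t (x t : R) : 0 < t ->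
  is_derive t 1 (sim_temp x) (alpha * (sim_grad x t * - (x / (2 * alpha * t)))).
Proof.
move=> t0; have st : 0 < Num.sqrt t by rewrite sqrtr_gt0.
have at0 : 0 < alpha * t by rewrite mulr_gt0.
have sqrtE : is_derive t 1 (fun u => Num.sqrt (alpha * u))
    ((2 * Num.sqrt (alpha * t))^-1 * alpha).
  have ? := is_derive1_sqrt at0.
  by apply: is_derive_eq; rewrite /GRing.scale/=; ring.
have sqrtVE : is_derive t 1 (fun u => (2 * Num.sqrt (alpha * u))^-1)
    (- (2 * Num.sqrt (alpha * t))^-2 * (2 * ((2 * Num.sqrt (alpha * t))^-1 * alpha))).
  apply: is_deriveV; first by rewrite mulf_neq0// gt_eqF// sqrtr_gt0.
rewrite /sim_temp; apply: is_derive_eq.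
rewrite /sim_grad; set e := expR _; rewrite /GRing.scale/=.
have aE := sqr_sqrtr (ltW alpha_gt0); have tE := sqr_sqrtr (ltW t0).
rewrite sqrtrM ?pi_ge0// sqrtrM ?(ltW alpha_gt0)//.
set a := Num.sqrt alpha in aE *; set b := Num.sqrt t in tE *.
by rewrite -aE -tE; field; rewrite !gt_eqF.
Qed.

End similarity_profile.

(** * Problem (P) for a triple of similarity form *)

Section similarity_solution.
Context {R : realType} (k rho c gamma q0 xi : R)
  (k_gt0 : 0 < k) (rho_gt0 : 0 < rho) (c_gt0 : 0 < c)
  (gamma_gt0 : 0 < gamma) (q0_gt0 : 0 < q0) (xi_gt0 : 0 < xi).

Let alpha := k / (rho * c).
Let nu := xi + gamma * k / (2 * q0 * Num.sqrt alpha) * expR (xi ^+ 2).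

Context (T : R -> R -> R) (s r : R -> R)
  (TsrE : similarity_form k rho c gamma q0 xi T s r).

Let alpha_gt0 : 0 < alpha.
Proof. by rewrite divr_gt0 ?mulr_gt0. Qed.

Let sqrt_alpha : 0 < Num.sqrt alpha.
Proof. by rewrite sqrtr_gt0. Qed.

Let sqrt_pi : 0 < Num.sqrt (pi : R).
Proof. by rewrite sqrtr_gt0 pi_gt0. Qed.

Let sqrt_alphat t : 0 < t -> 0 < Num.sqrt (alpha * t).
Proof. by move=> t0; rewrite sqrtr_gt0 mulr_gt0. Qed.

Let TE x t : 0 < t -> 0 < x -> x < s t -> T x t = sim_temp k alpha q0 xi x t.
Proof. by case: TsrE => + _ _; exact. Qed.

Let sE t : 0 < t -> s t = 2 * xi * Num.sqrt (alpha * t).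
Proof. by case: TsrE => _ + _; exact. Qed.

Let rE t : 0 < t -> r t = 2 * nu * Num.sqrt (alpha * t).
Proof. by case: TsrE => _ _; exact. Qed.

Let s_gt0 t : 0 < t -> 0 < s t.
Proof. by move=> t0; rewrite sE// !mulr_gt0 ?sqrt_alphat. Qed.

(** Serves both fronts, with [a] equal to [xi] for [s] and to [nu] for [r]. The formula for [f] at
    positive times suffices, since differentiation at [t > 0] is local. *)
Let is_derive_front (f : R -> R) (a t : R) :
  (forall u, 0 < u -> f u = 2 * a * Num.sqrt (alpha * u)) -> 0 < t ->
  is_derive t 1 f (a * Num.sqrt alpha / Num.sqrt t).
Proof.
move=> fE t0; have st : 0 < Num.sqrt t by rewrite sqrtr_gt0.
have at0 : 0 < alpha * t by rewrite mulr_gt0.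
apply: (@near_eq_is_derive _ _ _ (fun u => 2 * a * Num.sqrt (alpha * u))).
  by near=> u; rewrite fE//; near: u; exact: lt_nbhsr.
have ? := is_derive1_sqrt at0.
apply: is_derive_eq; rewrite /GRing.scale/= sqrtrM ?(ltW alpha_gt0)//.
have aE := sqr_sqrtr (ltW alpha_gt0); set b := Num.sqrt alpha in aE *.
by rewrite -aE; field; rewrite !gt_eqF.
Unshelve. all: by end_near. Qed.

Let near_T_x x t : 0 < t -> 0 < x -> x < s t ->
  \forall y \near x, sim_temp k alpha q0 xi y t = T y t.
Proof.
move=> t0 x0 xs; near=> y; rewrite TE//.
- by near: y; exact: lt_nbhsr.
- by near: y; exact: lt_nbhsl.
Unshelve. all: by end_near. Qed.

Let near_T_t x t : 0 < t -> 0 < x -> x < s t ->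
  \forall u \near t, sim_temp k alpha q0 xi x u = T x u.
Proof.
move=> t0 x0 xs; near=> u; rewrite TE//.
- by near: u; exact: lt_nbhsr.
(* The front moves with time: the point [x] stays behind it for [u] near [t] by continuity of
   [s]. *)
- near: u; apply: (cvgr_gt (s t)) => //.
  exact: is_derive1_cvg (is_derive_front sE t0).
Unshelve. all: by end_near. Qed.

Let is_derive_T_x x t : 0 < t -> 0 < x -> x < s t ->
  is_derive x 1 (T ^~ t) (sim_grad k alpha q0 x t).
Proof.
move=> t0 x0 xs; apply: near_eq_is_derive (near_T_x t0 x0 xs) _.
exact: is_derive_sim_temp_x.
Qed.

Let is_derive_T_t x t : 0 < t -> 0 < x -> x < s t ->
  is_derive t 1 (T x) (alpha * (sim_grad k alpha q0 x t * - (x / (2 * alpha * t)))).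
Proof.
move=> t0 x0 xs; apply: near_eq_is_derive (near_T_t t0 x0 xs) _.
exact: is_derive_sim_temp_t.
Qed.

Let dxTE x t : 0 < t -> 0 < x -> x < s t -> dx T x t = sim_grad k alpha q0 x t.
Proof. by move=> t0 x0 xs; exact: is_derive1E (is_derive_T_x t0 x0 xs). Qed.

Let is_derive_dxT_x x t : 0 < t -> 0 < x -> x < s t ->
  is_derive x 1 (dx T ^~ t) (sim_grad k alpha q0 x t * - (x / (2 * alpha * t))).
Proof.
move=> t0 x0 xs.
apply: (@near_eq_is_derive _ _ _ (sim_grad k alpha q0 ^~ t)).
  near=> y; rewrite dxTE//.
  - by near: y; exact: lt_nbhsr.
  - by near: y; exact: lt_nbhsl.
exact: is_derive_sim_grad_x.
Unshelve. all: by end_near. Qed.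

(** [T] is arbitrary outside [0 < x < s t], so its limit at the front is transferred from a profile
    [g] continuous there; [s t > 0] keeps points just left of the front inside the domain. *)
Let bval_s (f g : R -> R) t : 0 < t -> (forall x, 0 < x < s t -> f x = g x) ->
  g x @[x --> s t] --> g (s t) ->
  cvg_bval_left f (s t) /\ bval_left f (s t) = g (s t).
Proof.
move=> t0 fg cg; apply: bval_leftP.
apply: cvg_trans (cvg_at_left_filter cg); apply: near_eq_cvg; near=> x.
rewrite fg//; apply/andP; split; last by near: x; exact: nbhs_left_lt.
by near: x; apply: nbhs_left_gt; exact: s_gt0.
Unshelve. all: by end_near. Qed.

Let bval_0 (f g : R -> R) t : 0 < t -> (forall x, 0 < x < s t -> f x = g x) ->
  g x @[x --> (0 : R)] --> g 0 ->
  cvg_bval_right f 0 /\ bval_right f 0 = g 0.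
Proof.
move=> t0 fg cg; apply: bval_rightP.
apply: cvg_trans (cvg_at_right_filter cg); apply: near_eq_cvg; near=> x.
rewrite fg//; apply/andP; split; first by near: x; exact: nbhs_right_gt.
by near: x; apply: nbhs_right_lt; exact: s_gt0.
Unshelve. all: by end_near. Qed.

(** The similarity variable is constant along the front, so the profile vanishes there and the
    gradient carries [expR (- xi ^+ 2)]. *)
Let s_similarity t : 0 < t -> s t / (2 * Num.sqrt (alpha * t)) = xi.
Proof. by move=> t0; rewrite sE//; field; rewrite gt_eqF ?sqrt_alphat. Qed.

Let T_s t : 0 < t ->
  cvg_bval_left (T ^~ t) (s t) /\ bval_left (T ^~ t) (s t) = 0.
Proof.
move=> t0; have -> : 0 = sim_temp k alpha q0 xi (s t) t.
  by rewrite /sim_temp s_similarity// subrr mulr0.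
apply: (@bval_s (T ^~ t) (sim_temp k alpha q0 xi ^~ t) t) => //.
  by move=> x /andP[x0 xs]; rewrite TE.
exact: is_derive1_cvg (is_derive_sim_temp_x _ _ k_gt0 alpha_gt0 _ t0).
Qed.

Let dxT_s t : 0 < t -> cvg_bval_left (dx T ^~ t) (s t) /\
  bval_left (dx T ^~ t) (s t) = q0 / (k * Num.sqrt t) * expR (- xi ^+ 2).
Proof.
move=> t0; rewrite -[in expR _](s_similarity t0).
apply: (@bval_s (dx T ^~ t) (sim_grad k alpha q0 ^~ t) t) => //.
  by move=> x /andP[x0 xs]; rewrite dxTE.
exact: is_derive1_cvg (is_derive_sim_grad_x _ k_gt0 alpha_gt0 _ t0).
Qed.

Let T_0 t : 0 < t -> cvg_bval_right (T ^~ t) 0 /\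
  bval_right (T ^~ t) 0 = - (q0 * Num.sqrt (pi * alpha) / k * erf xi).
Proof.
move=> t0.
have -> : - (q0 * Num.sqrt (pi * alpha) / k * erf xi) = sim_temp k alpha q0 xi 0 t.
  by rewrite /sim_temp mul0r erf0 sub0r mulrN.
apply: (@bval_0 (T ^~ t) (sim_temp k alpha q0 xi ^~ t) t) => //.
  by move=> x /andP[x0 xs]; rewrite TE.
exact: is_derive1_cvg (is_derive_sim_temp_x _ _ k_gt0 alpha_gt0 _ t0).
Qed.

Let dxT_0 t : 0 < t -> cvg_bval_right (dx T ^~ t) 0 /\
  bval_right (dx T ^~ t) 0 = q0 / (k * Num.sqrt t).
Proof.
move=> t0; have -> : q0 / (k * Num.sqrt t) = sim_grad k alpha q0 0 t.
  by rewrite /sim_grad mul0r expr0n oppr0 expR0 mulr1.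
apply: (@bval_0 (dx T ^~ t) (sim_grad k alpha q0 ^~ t) t) => //.
  by move=> x /andP[x0 xs]; rewrite dxTE.
exact: is_derive1_cvg (is_derive_sim_grad_x _ k_gt0 alpha_gt0 _ t0).
Qed.

(** This and the next two identities reduce the radicals of the final formulas to [Num.sqrt alpha]
    and [Num.sqrt pi]. *)
Let sqrt_krhoc : Num.sqrt (k * rho * c) = k / Num.sqrt alpha.
Proof.
have -> : k * rho * c = k ^+ 2 / alpha by rewrite /alpha; field; rewrite !gt_eqF.
by rewrite sqrtrM ?sqr_ge0// sqrtr_sqr (gtr0_norm k_gt0) sqrtrV// ltW.
Qed.

Let sqrt_krhocpi : Num.sqrt (k * rho * c / pi) = k / (Num.sqrt alpha * Num.sqrt pi).
Proof.
rewrite sqrtrM ?mulr_ge0 ?ltW// sqrt_krhoc sqrtrV ?pi_ge0//.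
by field; rewrite !gt_eqF.
Qed.

Let sqrt_crhok : Num.sqrt (c / (rho * k)) = (rho * Num.sqrt alpha)^-1.
Proof.
have -> : c / (rho * k) = ((rho ^+ 2) * alpha)^-1.
  by rewrite /alpha; field; rewrite !gt_eqF.
rewrite sqrtrV; last by rewrite ltW// mulr_gt0// exprn_gt0.
by rewrite sqrtrM ?sqr_ge0// sqrtr_sqr (gtr0_norm rho_gt0).
Qed.

(** The initial values remain on the right because [similarity_form] prescribes [s] and [r] only at
    positive times. *)
Lemma similarity_solves_P (h0 Dinf eps l : R) :
  0 < h0 -> 0 < Dinf -> eps < 1 ->
  solves_P k rho c gamma q0 h0 Dinf eps l T s r <->
  [/\ r 0 = 0 /\ s 0 = 0,
      l = Num.sqrt (c / (rho * k)) * (q0 * expR (- xi ^+ 2) /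
        (xi + gamma * (1 - eps) * Num.sqrt (k * rho * c) / (2 * q0)
          * expR (xi ^+ 2))) &
      erf xi = Dinf / q0 * Num.sqrt (k * rho * c / pi) * (1 - q0 / (h0 * Dinf))].
Proof.
move=> h0_gt0 Dinf_gt0 eps_lt1.
have e_gt0 : 0 < expR (xi ^+ 2) by exact: expR_gt0.
have den_gt0 : 0 < xi + gamma * (1 - eps) * Num.sqrt (k * rho * c) / (2 * q0)
    * expR (xi ^+ 2).
  rewrite addr_gt0// mulr_gt0// divr_gt0 ?mulr_gt0 ?subr_gt0//.
  by rewrite sqrtr_gt0 !mulr_gt0.
have dsE t : 0 < t -> derive1 s t = xi * Num.sqrt alpha / Num.sqrt t.
  by move=> t0; exact: is_derive1E (is_derive_front sE t0).
have drE t : 0 < t -> derive1 r t = nu * Num.sqrt alpha / Num.sqrt t.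
  by move=> t0; exact: is_derive1E (is_derive_front rE t0).
(* [tau] stands for the root of the time: 1 is used to derive the formula for [l], [Num.sqrt t] to
   recover the flux condition at every [t]. *)
have flux tau : 0 < tau ->
    k * (q0 / (k * tau) * expR (- xi ^+ 2)) =
      rho * l * (eps * (xi * Num.sqrt alpha / tau)
                 + (1 - eps) * (nu * Num.sqrt alpha / tau)) <->
    l = Num.sqrt (c / (rho * k)) * (q0 * expR (- xi ^+ 2) /
        (xi + gamma * (1 - eps) * Num.sqrt (k * rho * c) / (2 * q0)
          * expR (xi ^+ 2))).
  move=> tau_gt0; rewrite sqrt_crhok.
  set D := xi + _; set a := Num.sqrt alpha.
  have -> : k * (q0 / (k * tau) * expR (- xi ^+ 2)) = q0 * expR (- xi ^+ 2) / tau.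
    by field; rewrite !gt_eqF.
  have -> : rho * l * (eps * (xi * a / tau) + (1 - eps) * (nu * a / tau)) =
      rho * a * (l * D) / tau.
    by rewrite /D /nu sqrt_krhoc -/a; field; rewrite !gt_eqF.
  split=> [E|->].
    have /mulIf/(_ _ _ E) -> : tau^-1 != 0 by rewrite invr_neq0// gt_eqF.
    by field; rewrite !gt_eqF.
  by field; rewrite !gt_eqF.
split=> [P|[init lE xiE]].
- split.
  + exact: P_init P.
  (* As time cancels, the single instant [t = 1] determines [l], and likewise [erf xi] below. *)
  + have := P_flux_s P ltr01.
    by rewrite (dxT_s ltr01).2 dsE// drE// sqrtr1 => /(flux _ ltr01).
  + have := P_convective_0 P ltr01; rewrite (dxT_0 ltr01).2 (T_0 ltr01).2.
    rewrite sqrt_krhocpi sqrtrM ?pi_ge0// sqrtr1.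
    set Y := _ / k * _ => E.
    (* [- Y] is the temperature at [x = 0]; dividing the convective condition by [h0] isolates
       it. *)
    have hE : q0 / h0 = Dinf - Y.
      have -> : q0 / h0 = k * (q0 / (k * 1)) / h0 by field; rewrite !gt_eqF.
      by rewrite E; field; rewrite gt_eqF.
    have -> : 1 - q0 / (h0 * Dinf) = (Dinf - q0 / h0) / Dinf.
      by field; rewrite !gt_eqF.
    by rewrite hE /Y; field; rewrite !gt_eqF.
split=> //.
- move=> x t t0 x0 xs; split.
  + by have [] := is_derive_T_t t0 x0 xs.
  + by have [] := is_derive_T_x t0 x0 xs.
  + by have [] := is_derive_dxT_x t0 x0 xs.
- move=> t t0; split.
  + by have [] := is_derive_front sE t0.
  + by have [] := is_derive_front rE t0.
- by move=> t t0; split; [exact: (T_s t0).1|exact: (dxT_s t0).1].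
- by move=> t t0; split; [exact: (T_0 t0).1|exact: (dxT_0 t0).1].
- move=> x t t0 x0 xs.
  rewrite /dt (is_derive1E (is_derive_T_t t0 x0 xs)).
  rewrite [dx _ _ _](is_derive1E (is_derive_dxT_x t0 x0 xs)).
  (* The two terms cancel because [alpha * (rho * c) = k]. *)
  by rewrite mulrA [rho * c * _]mulrC divfK ?subrr// mulf_neq0// gt_eqF.
- by move=> t /T_s[].
- move=> t t0; have st : 0 < Num.sqrt t by rewrite sqrtr_gt0.
  by rewrite (dxT_s t0).2 dsE// drE//; exact/flux.
(* The width [r t - s t] is proportional to [nu - xi], whose factor [expR (xi ^+ 2)] cancels the
   exponential in the gradient at [s], while the powers of [t] cancel too. *)
- move=> t t0; have st : 0 < Num.sqrt t by rewrite sqrtr_gt0.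
  rewrite (dxT_s t0).2 sE// rE// expRN sqrtrM ?(ltW alpha_gt0)// /nu.
  by field; rewrite !gt_eqF.
- move=> t t0; have st : 0 < Num.sqrt t by rewrite sqrtr_gt0.
  by rewrite (dxT_0 t0).2; field; rewrite !gt_eqF.
- move=> t t0; have st : 0 < Num.sqrt t by rewrite sqrtr_gt0.
  rewrite (dxT_0 t0).2 (T_0 t0).2 xiE sqrt_krhocpi sqrtrM ?pi_ge0//.
  by field; rewrite !gt_eqF.
Qed.

End similarity_solution.

(** * Existence criterion and formulas for the unknown coefficients *)

Theorem theorem3p1 (R : realType) (k rho c gamma q0 h0 Dinf eps : R)
  (k_gt0 : 0 < k) (rho_gt0 : 0 < rho) (c_gt0 : 0 < c) (gamma_gt0 : 0 < gamma)
  (q0_gt0 : 0 < q0) (h0_gt0 : 0 < h0) (Dinf_gt0 : 0 < Dinf)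
  (eps_gt0 : 0 < eps) (eps_lt1 : eps < 1) :
  ((exists (l xi : R) (T : R -> R -> R) (s r : R -> R),
      [/\ 0 < l, 0 < xi, similarity_form k rho c gamma q0 xi T s r &
          solves_P k rho c gamma q0 h0 Dinf eps l T s r])
   <->
   (0 < 1 - q0 / (h0 * Dinf) /\
    Dinf / q0 * Num.sqrt (k * rho * c / pi) * (1 - q0 / (h0 * Dinf)) < 1))
  /\
  (forall (l xi : R) (T : R -> R -> R) (s r : R -> R),
      0 < l -> 0 < xi -> similarity_form k rho c gamma q0 xi T s r ->
      solves_P k rho c gamma q0 h0 Dinf eps l T s r ->
      xi = erf_inv (Dinf / q0 * Num.sqrt (k * rho * c / pi) * (1 - q0 / (h0 * Dinf))) /\
      l = Num.sqrt (c / (rho * k)) *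
            (q0 * expR (- xi ^+ 2) /
             (xi + gamma * (1 - eps) * Num.sqrt (k * rho * c) / (2 * q0)
                     * expR (xi ^+ 2)))).
Proof.
set alpha := k / (rho * c).
have alpha_gt0 : 0 < alpha by rewrite divr_gt0// mulr_gt0.
set y := Dinf / q0 * _ * _.
have PE l xi T s r : 0 < xi -> similarity_form k rho c gamma q0 xi T s r -> _ :=
  fun xi_gt0 sf => similarity_solves_P k_gt0 rho_gt0 c_gt0 gamma_gt0 q0_gt0 xi_gt0
    sf l h0_gt0 Dinf_gt0 eps_lt1.
have coef_gt0 : 0 < Dinf / q0 * Num.sqrt (k * rho * c / pi).
  by rewrite mulr_gt0 ?divr_gt0// sqrtr_gt0 divr_gt0 ?pi_gt0// !mulr_gt0.
split; last first.
  move=> l xi T s r _ xi_gt0 sf /(PE _ _ _ _ _ xi_gt0 sf)[_ lE xiE].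
  by split=> //; rewrite /y -xiE erf_invK.
split=> [[l [xi [T [s [r [_ xi_gt0 sf]]]]]]|[b_gt0 y_lt1]].
  move=> /(PE _ _ _ _ _ xi_gt0 sf)[_ _ xiE].
  (* With [erf xi = y], the bound [erf xi < 1] is the second inequality; positivity of [erf xi]
     gives the first after removing the positive factor [coef_gt0]. *)
  have := erf_gt0 xi_gt0; have := erf_lt1 xi.
  by rewrite xiE -/y pmulr_rgt0.
have [|xi xi_gt0 xiE] := @erf_surj R y; first by rewrite y_lt1 mulr_gt0.
pose l := Num.sqrt (c / (rho * k)) * (q0 * expR (- xi ^+ 2) /
  (xi + gamma * (1 - eps) * Num.sqrt (k * rho * c) / (2 * q0) * expR (xi ^+ 2))).
pose s t := 2 * xi * Num.sqrt (alpha * t).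
pose r t := 2 * (xi + gamma * k / (2 * q0 * Num.sqrt alpha) * expR (xi ^+ 2))
  * Num.sqrt (alpha * t).
have sf : similarity_form k rho c gamma q0 xi (sim_temp k alpha q0 xi) s r by [].
exists l, xi, (sim_temp k alpha q0 xi), s, r; split; [|exact: xi_gt0|exact: sf|].
  rewrite mulr_gt0 ?sqrtr_gt0 ?divr_gt0 ?mulr_gt0 ?expR_gt0//.
  rewrite addr_gt0// mulr_gt0 ?expR_gt0// divr_gt0 ?mulr_gt0 ?subr_gt0//.
  by rewrite sqrtr_gt0 !mulr_gt0.
apply/(PE _ _ _ _ _ xi_gt0 sf); split; [|by []|exact: xiE].
(* The formulas for the fronts, used here at all times, vanish at [t = 0] because the root of 0 is
   0. *)
by rewrite /r /s mulr0 sqrtr0 !mulr0.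
Qed.
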